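(* Suppose $A$ is diagonalizable with eigendecomposition $A=\sum_{h=1}^n\lambda_hx_hy_h^*$ (where $X=[x_1,\dots,x_n]$ is an invertible eigenvector matrix and $y_h^*$ is the $h$-th row of $X^{-1}$). Then $$f(A)B-F_j=\sum_{h=1}^nx_hy_h^*\,\Pi_{U,Z}U_{j+1}\Gamma_{j+1}^U\,E_j^*K_{U,j}^{-1}\left[f(A_j^{U,Z})-f(\lambda_h)I\right](A_j^{U,Z}-\lambda_hI)^{-1}E_1R_B,$$ and $$\|f(A)B-F_j\|_F\le\gamma\max_{h=1,\dots,n}\left\|E_j^*K_{U,j}^{-1}\left[f(A_j^{U,Z})-f(\lambda_h)I\right](A_j^{U,Z}-\lambda_hI)^{-1}E_1R_B\right\|_2,$$ where $\gamma=\kappa_{\mathrm{eig}}(A)\,\|\Pi_{U,Z}U_{j+1}\Gamma_{j+1}^U\|_F$ and $\kappa_{\mathrm{eig}}(A)$ is the 2-norm condition number of an eigenvector matrix of $A$.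
   Context: Let $A\in\mathbb C^{n\times n}$, $B\in\mathbb C^{n\times s}$ with $s>1$, $j\ge 1$, and shifts $\Sigma=\{\sigma_1,\dots,\sigma_{j-1}\}\subset\mathbb C\cup\{\infty\}$, the finite ones not eigenvalues of $A$. Put $\varphi(z)=\prod_{\sigma_i\neq\infty}(z-\sigma_i)$ and $E_i=e_i\otimes I_s$ (size clear from the context). For an $s\times s$ matrix polynomial $P(\lambda)=\sum_i\lambda^iP_i$ and a block vector $W$ with $s$ columns, $P(N)\circ W:=\sum_iN^iWP_i$. Block rational Krylov spaces: $\mathcal{RK}^\square_j(A,B,\Sigma)=\{\varphi(A)^{-1}(P(A)\circ B):\deg P<j\}$ and $\mathcal{RK}^\square_{j+1}(A,B,\Sigma)=\{\varphi(A)^{-1}(P(A)\circ B):\deg P\le j\}$ (last pole at infinity). Standing assumptions. The block rational Arnoldi procedure for $\mathcal{RK}^\square_{j+1}(A,B,\Sigma)$ runs without breakdown or deflation (every generated block has full rank $s$), with the last pole at infinity. It gives a matrix with orthonormal columns $\mathbf U_{j+1}=[U_1,\dots,U_{j+1}]$, $U_i\in\mathbb C^{n\times s}$, such that $\mathcal{RK}^\square_m(A,B,\Sigma)=\{\sum_{i\le m}U_iC_i: C_i\in\mathbb C^{s\times s}\}$ for $m=j,j+1$, $B=U_1R_B$ with $R_B\in\mathbb C^{s\times s}$ invertible, and block upper Hessenberg $(j+1)s\times js$ matrices $\underline H_{U,j},\underline K_{U,j}$ (with $s\times s$ blocks) with $A\mathbf U_{j+1}\underline K_{U,j}=\mathbf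 U_{j+1}\underline H_{U,j}$ and last block row of $\underline K_{U,j}$ equal to zero. $H_{U,j},K_{U,j}$ are their top $js\times js$ parts ($K_{U,j}$ is invertible), and $\Gamma_{j+1}^U$ is the block of $\underline H_{U,j}$ in block position $(j+1,j)$. Let $\mathbf U_j=[U_1,\dots,U_j]$, and let $\mathbf Z_j\in\mathbb C^{n\times js}$ have orthonormal columns with $\mathbf Z_j^*\mathbf U_j$ invertible. Put $A_j^{U,Z}=(\mathbf Z_j^*\mathbf U_j)^{-1}\mathbf Z_j^*A\mathbf U_j$ and $\Pi_{U,Z}=I-\mathbf U_j(\mathbf Z_j^*\mathbf U_j)^{-1}\mathbf Z_j^*$. The finite shifts $\sigma_i$ are not eigenvalues of $A_j^{U,Z}$. The function $f$ is analytic in an open neighborhood of the eigenvalues of $A$ and of $A_j^{U,Z}$, no eigenvalue $\lambda_h$ of $A$ is an eigenvalue of $A_j^{U,Z}$, and the Petrov-Galerkin approximation of $f(A)B$ is $F_j=\mathbf U_jf(A_j^{U,Z})E_1R_B$. *)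

(* Defs.v *)
From HB Require Import structures.
From mathcomp Require Export all_boot all_order all_algebra.
From mathcomp Require Export complex.
From mathcomp Require Export all_classical all_reals all_analysis.

Set Implicit Arguments.
Unset Strict Implicit.
Unset Printing Implicit Defensive.

Import Order.TTheory GRing.Theory Num.Theory.
Import numFieldNormedType.Exports.

Local Open Scope classical_set_scope.
Local Open Scope ring_scope.
Local Open Scope sesquilinear_scope.

Section MatrixFunction.
Variable C : numClosedFieldType.
Implicit Types (f : C -> C) (p : {poly C}) (a : C).

Definition analytic_at f a : Prop :=
  exists (c : nat -> C) (r : C), 0 < r /\
    forall z, `|z - a| < r ->
      series (fun k => c k * (z - a) ^+ k) @ \oo --> f z.

Definition analytic_near f (S : set C) : Prop :=
  exists Omega : set C,
    [/\ open Omega, S `<=` Omega & forall a, Omega a -> analytic_at f a].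

(* [horner_mx] is restricted to matrices of successor size. *)
Definition mxhorner n p (A : 'M[C]_n) : 'M[C]_n :=
  \sum_(i < size p) p`_i *: A ^+ i.

(* p is a Hermite interpolant of f on the spectrum of A. The number of
   derivatives matched at an eigenvalue is its algebraic multiplicity, which is
   at least its index (its multiplicity in the minimal polynomial); the value
   p(A) is the same in both cases, see [hermite_interpolant_uniq]. *)
Definition hermite_interpolant n f (A : 'M[C]_n) p : Prop :=
  forall a (k : nat), (k < mup a (char_poly A))%N ->
    p^`(k).[a] = derive1n k f a.

Definition matfun n f (A : 'M[C]_n) : 'M[C]_n :=
  xget 0 [set mxhorner p A | p in hermite_interpolant f A].

End MatrixFunction.

Section HermiteInterpolation.
Variable C : numClosedFieldType.
Implicit Types (p q : {poly C}) (a : C) (r : seq C).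

Lemma prod_XsubC_count r a : exists2 w : {poly C}, w.[a] != 0 &
  \prod_(z <- r) ('X - z%:P) = ('X - a%:P) ^+ count_mem a r * w.
Proof.
exists (\prod_(z <- r | z != a) ('X - z%:P)).
  rewrite horner_prod prodf_seq_neq0; apply/allP => z _; apply/implyP => za.
  by rewrite hornerXsubC subr_eq0 eq_sym.
rewrite (bigID (pred1 a)) /=; congr (_ * _).
by rewrite (eq_bigr (fun=> 'X - a%:P)) ?prodr_const_seq ?big_const_seq
  -?size_filter ?iter_mulr_1 ?size_filter // => z /eqP->.
Qed.

Lemma mup_prod_XsubC r a : mup a (\prod_(z <- r) ('X - z%:P)) = count_mem a r.
Proof.
have [w wa ->] := prod_XsubC_count r a.
by rewrite mupMl ?mup_XsubCX ?eqxx.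
Qed.

Lemma derivn_XsubC_exp a m q k : (k <= m)%N ->
  (('X - a%:P) ^+ m * q)^`(k).[a] = ((k == m) * m`!)%:R * q.[a].
Proof.
elim: m q k => [|m IHm] q [|k] // lekm.
- by rewrite derivn0 expr0 mul1r mul1r.
- by rewrite derivn0 hornerM horner_exp hornerXsubC subrr expr0n !mul0r.
rewrite derivSn.
have -> : (('X - a%:P) ^+ m.+1 * q)^`()
    = ('X - a%:P) ^+ m * (m.+1%:R *: q + ('X - a%:P) * q^`()).
  rewrite derivM deriv_exp derivXsubC mul1r /= mulrDr mulrA -exprSr.
  by rewrite -scalerAr scaler_nat -mulrnAl.
rewrite IHm // eqSS factS !hornerE subrr mul0r addr0 mulrA -natrM.
by rewrite mulnAC.
Qed.

Lemma char_poly_split n (A : 'M[C]_n) :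
  {r | char_poly A = \prod_(z <- r) ('X - z%:P)}.
Proof.
have [r Er] := closed_field_poly_normal (char_poly A).
by exists r; rewrite {1}Er (monicP (char_poly_monic A)) scale1r.
Qed.

Lemma dvdp_prod_XsubC r p :
  (forall a k, (k < count_mem a r)%N -> p^`(k).[a] = 0) ->
  \prod_(z <- r) ('X - z%:P) %| p.
Proof.
elim: r => [|b r IHr] hp; first by rewrite big_nil dvd1p.
have /dvdpP[q Ep] : \prod_(z <- r) ('X - z%:P) %| p.
  by apply: IHr => a k lek; apply: hp; rewrite /= (leq_trans lek) ?leq_addl.
rewrite big_cons Ep dvdp_mul2r; last first.
  by apply/monic_neq0/monic_prod_XsubC.
have [w wb Ew] := prod_XsubC_count r b.
have := hp b (count_mem b r); rewrite /= eqxx ltnSn => /(_ isT).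
rewrite Ep Ew mulrCA derivn_XsubC_exp // eqxx mul1n hornerM => /eqP.
by rewrite !mulf_eq0 (negbTE wb) orbF pnatr_eq0 gtn_eqF ?fact_gt0 // dvdp_XsubCl.
Qed.

Lemma mxhornerE n p (A : 'M[C]_n.+1) : mxhorner p A = horner_mx A p.
Proof.
rewrite -[in RHS](coefK p) poly_def rmorph_sum; apply: eq_bigr => i _ /=.
by rewrite linearZ rmorphXn /= horner_mx_X.
Qed.

Lemma hermite_interpolant_uniq f n (A : 'M[C]_n) p q :
  hermite_interpolant f A p -> hermite_interpolant f A q ->
  mxhorner p A = mxhorner q A.
Proof.
case: n A => [|n] A hp hq; first by apply/matrixP => [[]].
rewrite !mxhornerE; apply/eqP; rewrite -subr_eq0 -rmorphB.
have [r Er] := char_poly_split A.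
have /dvdpP[u ->] : char_poly A %| p - q.
  rewrite Er; apply: dvdp_prod_XsubC => a k.
  rewrite -mup_prod_XsubC -Er => lek.
  by rewrite derivnB hornerD hornerN hp ?hq ?subrr.
by rewrite rmorphM /= Cayley_Hamilton mulr0.
Qed.

Lemma hermite_interpolant_exists f n (A : 'M[C]_n) :
  exists p, hermite_interpolant f A p.
Proof.
have [r Er] := char_poly_split A; rewrite /hermite_interpolant Er.
elim: r {Er} => [|b r [p hp]].
  by exists 0 => a k; rewrite mup_prod_XsubC.
have [w wb Ew] := prod_XsubC_count r b; set m := count_mem b r in Ew.
pose c := (derive1n m f b - p^`(m).[b]) / (m`!%:R * w.[b]).
exists (p + c *: \prod_(z <- r) ('X - z%:P)) => a k.
rewrite mup_prod_XsubC derivnD derivnZ hornerD hornerZ /=.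
have [lek _|] := ltnP k (count_mem a r).
  have [v _ ->] := prod_XsubC_count r a.
  rewrite derivn_XsubC_exp ?(ltnW lek) // (ltn_eqF lek) mul0n mul0r mulr0 addr0.
  by apply: hp; rewrite mup_prod_XsubC.
have [<-|_] := eqVneq b a => lek; last by rewrite add0n ltnNge lek.
rewrite add1n ltnS => gek; have -> : k = m by apply/eqP; rewrite eqn_leq gek.
rewrite Ew derivn_XsubC_exp // eqxx mul1n divfK ?subrKC //.
by rewrite mulf_neq0 // pnatr_eq0 gtn_eqF ?fact_gt0.
Qed.

Lemma matfunE f n (A : 'M[C]_n) p :
  hermite_interpolant f A p -> matfun f A = mxhorner p A.
Proof.
move=> hp; rewrite /matfun; case: xgetP => [_ -> [q hq <-]|/(_ (mxhorner p A))].
  exact: hermite_interpolant_uniq hq hp.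
by case; exists p.
Qed.

End HermiteInterpolation.

Section BlockKrylov.
Variable C : numClosedFieldType.
Variables n s : nat.
Implicit Types (A : 'M[C]_n) (B : 'M[C]_(n, s)).

(* P(A) o B, for the s x s matrix polynomial P(z) = \sum_(i < m) z^i P_i. *)
Definition circ m (P : 'I_m -> 'M[C]_s) A B : 'M[C]_(n, s) :=
  \sum_(i < m) A ^+ i *m B *m P i.

(* A pole is an element of option C, None being the pole at infinity. *)
Definition pole_poly (Sigma : seq (option C)) : {poly C} :=
  \prod_(a <- pmap id Sigma) ('X - a%:P).

Definition rat_krylov A B (Sigma : seq (option C)) m : set 'M[C]_(n, s) :=
  [set invmx (mxhorner (pole_poly Sigma) A) *m circ P A B
     | P in [set: 'I_m -> 'M[C]_s]].

Definition block_span m (U : 'I_m -> 'M[C]_(n, s)) : set 'M[C]_(n, s) :=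
  [set \sum_(i < m) U i *m D i | D in [set: 'I_m -> 'M[C]_s]].

Definition top_blocks j (M : 'M[C]_(\sum_(i < j.+1) s, \sum_(i < j) s)) :
    'M[C]_(\sum_(i < j) s, \sum_(i < j) s) :=
  \mxblock_(i < j, k < j) submxblock M (widen_ord (leqnSn j) i) k.

(* The block unit vector e_i (x) I_s. *)
Definition block_unit j (i : 'I_j) : 'M[C]_(\sum_(k < j) s, s) :=
  \mxcol_(k < j) ((k == i)%:R%:M : 'M[C]_s).

Definition first_blocks j (U : 'I_j.+1 -> 'M[C]_(n, s)) (i : 'I_j) :=
  U (widen_ord (leqnSn j) i).

(* Output of the block rational Arnoldi procedure with poles Sigma and infinity,
   without breakdown or deflation. *)
Record block_rational_arnoldi j A B (Sigma : seq (option C))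
    (U : 'I_j.+1 -> 'M[C]_(n, s)) (RB : 'M[C]_s)
    (H K : 'M[C]_(\sum_(i < j.+1) s, \sum_(i < j) s)) : Prop := {
  bra_orthonormal : (\mxrow_i U i)^t* *m (\mxrow_i U i) = 1%:M;
  bra_span : rat_krylov A B Sigma j = block_span (first_blocks U);
  bra_spanS : rat_krylov A B Sigma j.+1 = block_span U;
  bra_start : B = U ord0 *m RB;
  bra_start_unit : RB \in unitmx;
  bra_hessenbergH : forall (i : 'I_j.+1) (k : 'I_j),
    (k.+1 < i)%N -> submxblock H i k = 0;
  bra_hessenbergK : forall (i : 'I_j.+1) (k : 'I_j),
    (k.+1 < i)%N -> submxblock K i k = 0;
  bra_relation : A *m (\mxrow_i U i) *m K = (\mxrow_i U i) *m H;
  bra_lastK : forall k, submxblock K ord_max k = 0;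
  bra_topK_unit : top_blocks K \in unitmx
}.

(* U and Z are n x m with m = js, that is, U_j and Z_j in the text. *)
Definition pg_matrix m A (U Z : 'M[C]_(n, m)) : 'M[C]_m :=
  invmx (Z^t* *m U) *m (Z^t* *m A *m U).

Definition pg_oblique m (U Z : 'M[C]_(n, m)) : 'M[C]_n :=
  1%:M - U *m invmx (Z^t* *m U) *m Z^t*.

End BlockKrylov.

Section Norms.
Variable R : realType.

Definition frobenius_norm m n (M : 'M[R[i]]_(m, n)) : R :=
  Num.sqrt (\sum_i \sum_j Normc.normc (M i j) ^+ 2).

(* The 2-norm is the operator norm for the Euclidean norm, which is the
   Frobenius norm of a column. *)
Definition norm2 m n (M : 'M[R[i]]_(m, n)) : R :=
  sup [set frobenius_norm (M *m v) | v in
         [set v : 'cV[R[i]]_n | frobenius_norm v <= 1]].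

Definition cond2 n (X : 'M[R[i]]_n) : R := norm2 X * norm2 (invmx X).

End Norms.

(* Main.v *)
From mathcomp Require Import ring.
Require Import Defs.

(** The compression [A_j] of [A] satisfies [A U_j - U_j A_j = Pi A U_j], and the
    Arnoldi relation together with [Pi U_j = 0] reduces the right-hand side to
    [W L], where [W = Pi U_{j+1} Gamma] and [L = E_j^* K^-1]
    ([arnoldi_residual], [mulmx_pg_matrix]). A left eigenvector [y_h] of [A]
    then satisfies [y_h U_j (lambda_h - A_j) = y_h W L], so that
    [y_h U_j = - y_h W L (A_j - lambda_h)^-1]
    ([left_eigenvector_sylvester]). Since [B = U_j E_1 R_B], inserting the
    resolution of the identity [sum_h x_h y_h] in the error [f(A) B - F_j] and
    using [y_h f(A) = f(lambda_h) y_h] gives the formula, because [f(A_j)] is a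
    polynomial in [A_j] and commutes with the resolvent
    ([matfun_compression_error]).

    For the bound, write the formula as [X M], where the row [h] of [M] is
    [y_h W] times the factor [G_h] that depends on [lambda_h]. The Frobenius
    norm of [M] is at most [max_h |G_h|_2] times that of [X^-1 W], row by row
    ([frob_stacked_rows]), and each of the factors [X] and [X^-1] costs its
    2-norm ([frob_mulmx_norm2]); the product of these two norms is the condition
    number of [X]. *)

Set Implicit Arguments.
Unset Strict Implicit.
Unset Printing Implicit Defensive.
Import Order.TTheory GRing.Theory Num.Theory.
Import numFieldNormedType.Exports.
Local Open Scope classical_set_scope.
Local Open Scope ring_scope.
Local Open Scope sesquilinear_scope.

(** * Functions of a diagonalizable matrix and their compressions *)

Section MatrixFunctions.
Variable C : numClosedFieldType.

Lemma mulmx_exp_eigen n (A : 'M[C]_n) (y : 'rV[C]_n) a k :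
  y *m A = a *: y -> y *m A ^+ k = a ^+ k *: y.
Proof.
move=> yA; elim: k => [|k IHk]; first by rewrite !expr0 mulmx1 scale1r.
by rewrite !exprSr -mulmxE mulmxA IHk -scalemxAl yA scalerA.
Qed.

Lemma mulmx_mxhorner_eigen n (A : 'M[C]_n) (y : 'rV[C]_n) a p :
  y *m A = a *: y -> y *m mxhorner p A = p.[a] *: y.
Proof.
move=> yA; rewrite /mxhorner mulmx_sumr horner_coef scaler_suml.
by apply: eq_bigr => k _; rewrite -scalemxAr (mulmx_exp_eigen _ yA) scalerA.
Qed.

Lemma comm_mxhorner n (A : 'M[C]_n) p : comm_mx A (mxhorner p A).
Proof.
apply: comm_mx_sum => i _; rewrite /comm_mx -scalemxAr -scalemxAl.
by congr (_ *: _); rewrite mulmxE -exprS -exprSr.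
Qed.

(** By its definition [matfun f A] is a polynomial in [A]. *)
Lemma comm_matfun n f (A : 'M[C]_n) : comm_mx A (matfun f A).
Proof.
have [p hp] := hermite_interpolant_exists f A.
by rewrite (matfunE hp); apply: comm_mxhorner.
Qed.

(** A Hermite interpolant of [f] agrees with [f] itself, as its zeroth derivative,
    at every root of the characteristic polynomial; along an eigenvector the
    higher derivatives that it also matches are not seen. *)
Lemma mulmx_matfun_eigen n f (A : 'M[C]_n) (y : 'rV[C]_n) a :
  y *m A = a *: y -> y *m matfun f A = f a *: y.
Proof.
move=> yA; have [->|y0] := eqVneq y 0; first by rewrite mul0mx scaler0.
have [p hp] := hermite_interpolant_exists f A.
rewrite (matfunE hp) (mulmx_mxhorner_eigen _ yA); congr (_ *: _).
have : root (char_poly A) a.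
  by rewrite -eigenvalue_root_char; apply/eigenvalueP; exists y.
(* A root has multiplicity at least 1, so that the order 0 is interpolated. *)
rewrite -dvdp_XsubCl -['X - _]expr1 -mup_geq ?monic_neq0 ?char_poly_monic //.
by move=> /hp.
Qed.

Lemma unitmx_sub_scalar n (A : 'M[C]_n) a :
  ~~ eigenvalue A a -> A - a%:M \in unitmx.
Proof.
rewrite unitmxE unitfE; apply: contraNneq => /eqP/det0P[v v0 vA].
apply/eigenvalueP; exists v => //; apply/eqP.
by rewrite -subr_eq0 -mul_mx_scalar -mulmxBr vA.
Qed.

Lemma comm_mx_invmx n (A B : 'M[C]_n) :
  A \in unitmx -> comm_mx A B -> comm_mx (invmx A) B.
Proof.
move=> uA cAB; rewrite /comm_mx -[in RHS](mulKmx uA B) cAB.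
by rewrite -!mulmxA mulmxV // mulmx1.
Qed.

(** The rank-one decomposition of a product, used in two ways: to read a sum over
    eigenvectors as a product with the eigenvector matrix, and to resolve the
    identity into spectral projectors. *)
Lemma sum_col_mulmx n m k (X : 'M[C]_(k, n)) (r : 'I_n -> 'M[C]_(1, m)) :
  \sum_h col h X *m r h = X *m \matrix_h r h.
Proof.
apply/matrixP => i k'; rewrite summxE !mxE.
by apply: eq_bigr => h _; rewrite !mxE big_ord1 !mxE.
Qed.

Lemma sum_col_row n (X : 'M[C]_n) :
  X \in unitmx -> \sum_h col h X *m row h (invmx X) = 1%:M.
Proof.
move=> uX; rewrite sum_col_mulmx -[RHS](mulmxV uX); congr (_ *m _).
by apply/row_matrixP => h; rewrite rowK.
Qed.

Lemma row_invmx_eigen n (A X : 'M[C]_n) (lambda : 'I_n -> C) h :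
  X \in unitmx ->
  A = \sum_(k < n) lambda k *: (col k X *m row k (invmx X)) ->
  row h (invmx X) *m A = lambda h *: row h (invmx X).
Proof.
move=> uX ->; under eq_bigr => k _ do rewrite scalemxAr.
by rewrite sum_col_mulmx -row_mul mulKmx // rowK.
Qed.

Lemma matfun_diag n f (A X : 'M[C]_n) (lambda : 'I_n -> C) :
  X \in unitmx ->
  A = \sum_(h < n) lambda h *: (col h X *m row h (invmx X)) ->
  matfun f A = \sum_(h < n) f (lambda h) *: (col h X *m row h (invmx X)).
Proof.
move=> uX EA; rewrite -[LHS]mul1mx -(sum_col_row uX) mulmx_suml.
apply: eq_bigr => h _; rewrite -mulmxA.
by rewrite (mulmx_matfun_eigen _ (row_invmx_eigen h uX EA)) scalemxAr.
Qed.

(** Multiplying the residual relation by the left eigenvector turns [A] into the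
    scalar [a], and leaves the linear equation [y V (T - a) = - y W] for [y V].
    The resolvent of [T] in the error formula comes from solving it. *)
Lemma left_eigenvector_sylvester n m (A : 'M[C]_n) (T : 'M[C]_m)
    (V W : 'M[C]_(n, m)) (y : 'rV[C]_n) a :
  A *m V = V *m T + W -> y *m A = a *: y -> T - a%:M \in unitmx ->
  y *m V = - (y *m W *m invmx (T - a%:M)).
Proof.
move=> AV yA uT.
have yW : y *m W = - (y *m V *m (T - a%:M)).
  rewrite mulmxBr mul_mx_scalar opprB scalemxAl -yA -[y *m A *m V]mulmxA AV.
  by rewrite mulmxDr mulmxA addrAC subrr add0r.
by rewrite yW mulNmx opprK mulmxK.
Qed.

(** Error of the compression [V f(T) b] of [f(A) V b] when [A V] and [V T] differ
    by [W]. The spectral projectors of [A] split the error into the terms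
    [x_h y_h (f(lambda_h) - f(T))] applied to [V b], in which [y_h V] is known
    from the residual; the sign of [y_h V] is absorbed by exchanging [f(T)] and
    [f(lambda_h)]. *)
Lemma matfun_compression_error n m s f (A X : 'M[C]_n) (lambda : 'I_n -> C)
    (T : 'M[C]_m) (V W : 'M[C]_(n, m)) (b : 'M[C]_(m, s)) :
  X \in unitmx ->
  A = \sum_(h < n) lambda h *: (col h X *m row h (invmx X)) ->
  A *m V = V *m T + W ->
  (forall a, eigenvalue A a -> ~~ eigenvalue T a) ->
  matfun f A *m (V *m b) - V *m matfun f T *m b
    = \sum_(h < n) col h X *m row h (invmx X) *m W
        *m (matfun f T - (f (lambda h))%:M) *m invmx (T - (lambda h)%:M) *m b.
Proof.
move=> uX EA AV disj.
rewrite -[V *m _ *m b]mul1mx -(sum_col_row uX) (matfun_diag f uX EA).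
rewrite !mulmx_suml -sumrB; apply: eq_bigr => h _.
have yA := row_invmx_eigen h uX EA.
have y0 : row h (invmx X) != 0.
  apply/eqP => y0; have /eqP := oner_neq0 C; apply.
  have /rowP/(_ h) : row h (1%:M : 'M[C]_n) = 0.
    by rewrite -(mulVmx uX) row_mul y0 mul0mx.
  by rewrite !mxE eqxx.
have uT : T - (lambda h)%:M \in unitmx.
  by apply/unitmx_sub_scalar/disj/eigenvalueP; exists (row h (invmx X)).
(* Solving for [y_h V] puts the resolvent before the difference of functions;
   the formula has it after. *)
have commR : comm_mx (invmx (T - (lambda h)%:M))
                     (matfun f T - (f (lambda h))%:M).
  apply: comm_mx_invmx => //; apply: comm_mxB; last exact: comm_mx_scalar.
  apply/comm_mx_sym/comm_mxB; first exact/comm_mx_sym/comm_matfun.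
  exact: comm_mx_scalar.
rewrite -!scalemxAl -!mulmxA scalemxAr -mulmxBr; congr (_ *m _).
rewrite !mulmxA -[_ *m (matfun f T - _) *m _]mulmxA -commR !mulmxA.
have /(congr1 -%R) := left_eigenvector_sylvester AV yA uT.
rewrite opprK => <-.
by rewrite mulNmx mulmxBr mul_mx_scalar opprB mulmxBl -scalemxAl.
Qed.

End MatrixFunctions.

(** * The residual of the Arnoldi basis *)

Section ArnoldiResidual.
Variable C : numClosedFieldType.

Lemma block_unit_adj j s (i : 'I_j) :
  (block_unit C s i)^t* = \mxrow_(k < j) ((k == i)%:R%:M : 'M[C]_s).
Proof.
rewrite /block_unit tr_mxcol; apply/matrixP => a b; rewrite !mxE.
by rewrite rmorphMn rmorph_nat; congr (_ *+ _); rewrite eq_sym.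
Qed.

Lemma mulmx_block_unit j n s (U : 'I_j -> 'M[C]_(n, s)) i :
  (\mxrow_k U k) *m block_unit C s i = U i.
Proof.
rewrite mul_mxrow_mxcol (bigD1 i) //= eqxx mulmx1 big1 ?addr0 // => k ki.
by rewrite (negbTE ki) raddf0 mulmx0.
Qed.

(** Both sides of the Arnoldi relation are of this shape; separating the last
    block row confines [U_{j+1}] to a single term. *)
Lemma mul_mxrow_top_blocks j n s (U : 'I_j.+1 -> 'M[C]_(n, s))
    (M : 'M[C]_(\sum_(i < j.+1) s, \sum_(i < j) s)) :
  (\mxrow_i U i) *m M = (\mxrow_i first_blocks U i) *m top_blocks M
    + U ord_max *m \mxrow_k submxblock M ord_max k.
Proof.
rewrite -[in LHS](submxblockK M) !mul_mxrow_mxblock mul_mxrow -mxrowD.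
by apply/eq_mxrowP => k; rewrite big_ord_recr.
Qed.

(** By the Hessenberg form the last block row of [H] is [Gamma E_j^*], and that of
    [K] vanishes, so that inverting the top part of [K] expresses [A U_j] in the
    basis [U_j] up to a term in the range of [U_{j+1}]. *)
Lemma arnoldi_residual n s j A B Sigma (U : 'I_j.+2 -> 'M[C]_(n, s)) RB
    (H K : 'M[C]_(\sum_(i < j.+2) s, \sum_(i < j.+1) s)) :
  block_rational_arnoldi A B Sigma U RB H K ->
  A *m (\mxrow_i first_blocks U i)
  = (\mxrow_i first_blocks U i) *m (top_blocks H *m invmx (top_blocks K))
    + U ord_max *m submxblock H ord_max ord_max
      *m (block_unit C s (ord_max : 'I_j.+1))^t* *m invmx (top_blocks K).
Proof.
case=> _ _ _ _ _ hessH _ rel lastK uK.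
have lastH : \mxrow_k submxblock H ord_max k
    = submxblock H ord_max ord_max *m (block_unit C s (ord_max : 'I_j.+1))^t*.
  rewrite block_unit_adj mul_mxrow; apply/eq_mxrowP => k.
  have [->|k_max] := eqVneq k ord_max; first by rewrite mulmx1.
  (* Only the last column has its subdiagonal block in the last row. *)
  rewrite raddf0 mulmx0 hessH // ltn_neqAle ltn_ord andbT eqSS.
  by apply: contraNneq k_max => km; apply/eqP/val_inj.
have lastK0 : \mxrow_k submxblock K ord_max k = 0.
  by under eq_mxrow => k do rewrite lastK; rewrite mxrow0.
move: rel; rewrite -mulmxA !mul_mxrow_top_blocks lastH lastK0 mulmx0 addr0.
move=> /(congr1 (mulmx^~ (invmx (top_blocks K)))).
by rewrite mulmxDl !mulmxA mulmxK.
Qed.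

(** [V] times the Petrov-Galerkin matrix is the oblique projection of [A V], whose
    complement is the Petrov-Galerkin residual. *)
Lemma mulmx_pg_matrix n m (A : 'M[C]_n) (V Z : 'M[C]_(n, m)) :
  A *m V = V *m pg_matrix A V Z + pg_oblique V Z *m (A *m V).
Proof. by rewrite /pg_matrix /pg_oblique mulmxBl mul1mx !mulmxA subrKC. Qed.

Lemma pg_oblique_basis n m (V Z : 'M[C]_(n, m)) :
  Z^t* *m V \in unitmx -> pg_oblique V Z *m V = 0.
Proof. by move=> uZV; rewrite mulmxBl mul1mx -!mulmxA mulVmx ?mulmx1 ?subrr. Qed.

End ArnoldiResidual.

(** * Frobenius norm and 2-norm *)

Section NormBounds.
Variable R : realType.
Local Notation normc := (@Normc.normc R).

Lemma normr_normc (z : R[i]) : `|z| = (normc z)%:C%C.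
Proof. by case: z. Qed.

Lemma normc_ge0 (z : R[i]) : 0 <= normc z.
Proof. by case: z => a b; apply: sqrtr_ge0. Qed.

Lemma normc_conj (z : R[i]) : normc z^* = normc z.
Proof. by apply: complexI; rewrite -!normr_normc norm_conjC. Qed.

Lemma normc_real (x : R) : 0 <= x -> normc (x%:C)%C = x.
Proof. by move=> x0; rewrite /= expr0n addr0 sqrtr_sqr ger0_norm. Qed.

Lemma normc_sum_mul (I : finType) (a b : I -> R[i]) :
  normc (\sum_i a i * b i) <= \sum_i normc (a i) * normc (b i).
Proof.
apply: (big_ind2 (fun z x => normc z <= x)) => [|z x z' x' zx zx'|i _].
- by rewrite Normc.normc0.
- by apply: le_trans (lerD zx zx'); apply: le_normcD.
- by rewrite Normc.normcM.
Qed.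

Lemma sum_sqr_ge0 (I : finType) (F : I -> R) : 0 <= \sum_i F i ^+ 2.
Proof. by apply: sumr_ge0 => i _; apply: sqr_ge0. Qed.

(** Lagrange's identity: the difference of the two sides is half the sum of the
    squares of all the two-by-two minors of [a] and [b]. *)
Lemma sum_CauchySchwarz (I : finType) (a b : I -> R) :
  (\sum_i a i * b i) ^+ 2 <= (\sum_i a i ^+ 2) * (\sum_i b i ^+ 2).
Proof.
have lagrange : 0 <= \sum_i \sum_j (a i * b j - a j * b i) ^+ 2.
  by apply: sumr_ge0 => i _; apply: sum_sqr_ge0.
suff E : \sum_i \sum_j (a i * b j - a j * b i) ^+ 2
    = 2 * ((\sum_i a i ^+ 2) * (\sum_i b i ^+ 2) - (\sum_i a i * b i) ^+ 2).
  by move: lagrange; rewrite E pmulr_rge0 // subr_ge0.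
transitivity (\sum_i \sum_j (a i ^+ 2 * b j ^+ 2)
    + \sum_i \sum_j (b i ^+ 2 * a j ^+ 2)
    - 2 * \sum_i \sum_j (a i * b i) * (a j * b j)).
  rewrite mulr_sumr -big_split -sumrB; apply: eq_bigr => i _ /=.
  rewrite mulr_sumr -big_split -sumrB; apply: eq_bigr => j _ /=.
  by rewrite sqrrB !exprMn -[X in _ - X + _]mulr_natl; ring.
by rewrite -!big_distrlr /=; ring.
Qed.

Local Notation frob := (@frobenius_norm R _ _).

Lemma frob_ge0 m n (M : 'M[R[i]]_(m, n)) : 0 <= frob M.
Proof. exact: sqrtr_ge0. Qed.

Lemma frob_sqr m n (M : 'M[R[i]]_(m, n)) :
  frob M ^+ 2 = \sum_i \sum_j normc (M i j) ^+ 2.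
Proof. by rewrite sqr_sqrtr // sumr_ge0 // => i _; apply: sum_sqr_ge0. Qed.

Lemma frob_sqr_row m n (M : 'M[R[i]]_(m, n)) :
  frob M ^+ 2 = \sum_i frob (row i M) ^+ 2.
Proof.
rewrite frob_sqr; apply: eq_bigr => i _; rewrite frob_sqr big_ord1.
by apply: eq_bigr => j _; rewrite mxE.
Qed.

Lemma frob_sqr_col m n (M : 'M[R[i]]_(m, n)) :
  frob M ^+ 2 = \sum_j frob (col j M) ^+ 2.
Proof.
rewrite frob_sqr exchange_big; apply: eq_bigr => j _; rewrite frob_sqr.
by apply: eq_bigr => i _; rewrite big_ord1 mxE.
Qed.

Lemma frob_le m n m' n' (M : 'M[R[i]]_(m, n)) (N : 'M[R[i]]_(m', n')) c :
  0 <= c -> frob M ^+ 2 <= c ^+ 2 * frob N ^+ 2 -> frob M <= c * frob N.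
Proof.
move=> c0; rewrite -exprMn ler_pXn2r // nnegrE ?frob_ge0 //.
exact/mulr_ge0/frob_ge0.
Qed.

Lemma frobZ m n a (M : 'M[R[i]]_(m, n)) : frob (a *: M) = normc a * frob M.
Proof.
apply: (@pexpIrn _ 2) => //; rewrite ?nnegrE ?frob_ge0 //.
  exact/mulr_ge0/frob_ge0/normc_ge0.
rewrite exprMn !frob_sqr mulr_sumr; apply: eq_bigr => i _.
rewrite mulr_sumr; apply: eq_bigr => j _.
by rewrite mxE Normc.normcM exprMn.
Qed.

Lemma normc_mul_row_col n (r : 'rV[R[i]]_n) (v : 'cV[R[i]]_n) :
  normc ((r *m v) 0 0) <= frob r * frob v.
Proof.
rewrite -(@ler_pXn2r _ 2) ?nnegrE ?normc_ge0 ?mulr_ge0 ?frob_ge0 //.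
rewrite exprMn mxE !frob_sqr big_ord1 [X in _ * X]exchange_big /= big_ord1.
apply: le_trans (sum_CauchySchwarz _ _); rewrite ler_pXn2r ?nnegrE ?normc_ge0 //.
  exact: normc_sum_mul.
by apply: sumr_ge0 => i _; rewrite mulr_ge0 ?normc_ge0.
Qed.

Lemma frob_mulmx_col m n (M : 'M[R[i]]_(m, n)) (v : 'cV[R[i]]_n) :
  frob (M *m v) <= frob M * frob v.
Proof.
apply: frob_le; first exact: frob_ge0.
rewrite frob_sqr (frob_sqr_row M) mulr_suml; apply: ler_sum => i _.
rewrite big_ord1 -exprMn ler_pXn2r ?nnegrE ?normc_ge0 ?mulr_ge0 ?frob_ge0 //.
have -> : (M *m v) i 0 = (row i M *m v) 0 0 by rewrite -row_mul [RHS]mxE.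
exact: normc_mul_row_col.
Qed.

(** The supremum in the definition of the 2-norm bounds its set only when some
    bound exists; by Cauchy-Schwarz on each row, the Frobenius norm is one. *)
Lemma norm2_has_ubound m n (M : 'M[R[i]]_(m, n)) :
  has_ubound [set frob (M *m v) | v in [set v : 'cV[R[i]]_n | frob v <= 1]].
Proof.
exists (frob M) => _ [v /= v1 <-].
by apply: le_trans (frob_mulmx_col _ _) _; rewrite ler_piMr ?frob_ge0.
Qed.

Lemma frob0 m n : frob (0 : 'M[R[i]]_(m, n)) = 0.
Proof. by rewrite -(scale0r 0) frobZ Normc.normc0 mul0r. Qed.

Lemma norm2_ge0 m n (M : 'M[R[i]]_(m, n)) : 0 <= norm2 M.
Proof.
apply: (ub_le_sup (norm2_has_ubound M)); exists 0 => /=; last first.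
  by rewrite mulmx0 frob0.
by rewrite frob0 ler01.
Qed.

Lemma frob_mulmx_col_norm2 m n (M : 'M[R[i]]_(m, n)) (v : 'cV[R[i]]_n) :
  frob (M *m v) <= norm2 M * frob v.
Proof.
have [v0|v0] := eqVneq (frob v) 0.
  by apply: le_trans (frob_mulmx_col _ _) _; rewrite v0 !mulr0.
have vgt0 : 0 < frob v by rewrite lt_def v0 frob_ge0.
have frob_scaled k l (N : 'M[R[i]]_(k, l)) :
    frob ((frob v)^-1%:C%C *: N) = (frob v)^-1 * frob N.
  by rewrite frobZ normc_real // invr_ge0 frob_ge0.
rewrite mulrC -ler_pdivrMl // -frob_scaled scalemxAr.
apply: (ub_le_sup (norm2_has_ubound M)).
by exists ((frob v)^-1%:C%C *: v) => //=; rewrite frob_scaled mulVf.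
Qed.

(** The squared Frobenius norm is the sum over the columns, to each of which the
    definition of the 2-norm applies. *)
Lemma frob_mulmx_norm2 m n p (M : 'M[R[i]]_(m, n)) (N : 'M[R[i]]_(n, p)) :
  frob (M *m N) <= norm2 M * frob N.
Proof.
apply: frob_le; first exact: norm2_ge0.
rewrite frob_sqr_col (frob_sqr_col N) mulr_sumr; apply: ler_sum => j _.
rewrite -exprMn ler_pXn2r ?nnegrE ?mulr_ge0 ?frob_ge0 ?norm2_ge0 //.
by rewrite colE -mulmxA -colE frob_mulmx_col_norm2.
Qed.

(** The 2-norm is defined by its action on columns; its action on rows is reached
    by duality: for [w = r G] and the column [v] adjoint to [w], the number
    [w v = r (G v)] is the square of the norm of [w], and Cauchy-Schwarz bounds
    it by the norms of [r] and of the column [G v]. *)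
Lemma frob_row_mulmx_norm2 m n (r : 'rV[R[i]]_m) (G : 'M[R[i]]_(m, n)) :
  frob (r *m G) <= norm2 G * frob r.
Proof.
set w := r *m G; have [w0|w0] := eqVneq (frob w) 0.
  by rewrite w0 mulr_ge0 ?norm2_ge0 ?frob_ge0.
have wgt0 : 0 < frob w by rewrite lt_def w0 frob_ge0.
have adj_w : frob (w^t*) = frob w.
  apply: (@pexpIrn _ 2) => //; rewrite ?nnegrE ?frob_ge0 // !frob_sqr.
  rewrite exchange_big /=; apply: eq_bigr => i _; apply: eq_bigr => j _.
  by rewrite !mxE normc_conj.
have ww : normc ((r *m (G *m w^t*)) 0 0) = frob w ^+ 2.
  rewrite mulmxA -/w mxE frob_sqr big_ord1 -[RHS]normc_real.
    congr Normc.normc; rewrite rmorph_sum; apply: eq_bigr => j _.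
    by rewrite !mxE -normCK normr_normc rmorphXn.
  exact: sum_sqr_ge0.
rewrite -(ler_pM2r wgt0) -expr2 -ww mulrAC -adj_w mulrC.
apply: le_trans (normc_mul_row_col _ _) _.
by rewrite ler_wpM2l ?frob_ge0 ?frob_mulmx_col_norm2.
Qed.

(** The different factors [G h] act on different rows, and squared Frobenius norms
    add over rows; this is why the maximum over [h] suffices in the error bound
    instead of a sum. *)
Lemma frob_stacked_rows n m s (M : 'M[R[i]]_(n, m))
    (G : 'I_n -> 'M[R[i]]_(m, s)) c :
  0 <= c -> (forall h, norm2 (G h) <= c) ->
  frob (\matrix_h (row h M *m G h)) <= c * frob M.
Proof.
move=> c0 Gc; apply: frob_le => //.
rewrite frob_sqr_row (frob_sqr_row M) mulr_sumr; apply: ler_sum => h _.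
rewrite rowK -exprMn ler_pXn2r ?nnegrE ?mulr_ge0 ?frob_ge0 //.
apply: le_trans (frob_row_mulmx_norm2 _ _) _.
by rewrite ler_wpM2r ?frob_ge0.
Qed.

Lemma frob_eigen_sum n m s (X : 'M[R[i]]_n) (W : 'M[R[i]]_(n, m))
    (G : 'I_n -> 'M[R[i]]_(m, s)) :
  frob (\sum_(h < n) col h X *m row h (invmx X) *m W *m G h)
    <= cond2 X * frob W * \big[Num.max/0]_(h < n) norm2 (G h).
Proof.
set c := \big[Num.max/0]_h _; have c0 : 0 <= c by apply: bigmax_ge_id.
under eq_bigr => h _ do rewrite -2!mulmxA [row _ _ *m _]mulmxA -row_mul.
rewrite sum_col_mulmx; apply: le_trans (frob_mulmx_norm2 _ _) _.
rewrite /cond2 -!mulrA ler_wpM2l ?norm2_ge0 // mulrA [leRHS]mulrC.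
apply: (@le_trans _ _ (c * frob (invmx X *m W))).
  by apply: frob_stacked_rows => // h; apply: le_bigmax.
by rewrite ler_wpM2l ?frob_mulmx_norm2.
Qed.

End NormBounds.

(** * The Petrov-Galerkin error *)

(* The number j >= 1 of the text is j'.+1. *)
Theorem corollary3p5 (R : realType) (n s j' : nat)
    (A : 'M[R[i]]_n) (B : 'M[R[i]]_(n, s))
    (Sigma : j'.-tuple (option R[i]))
    (U : 'I_j'.+2 -> 'M[R[i]]_(n, s)) (RB : 'M[R[i]]_s)
    (H K : 'M[R[i]]_(\sum_(i < j'.+2) s, \sum_(i < j'.+1) s))
    (Z : 'M[R[i]]_(n, \sum_(i < j'.+1) s))
    (f : R[i] -> R[i]) (lambda : 'I_n -> R[i]) (X : 'M[R[i]]_n) :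
  let Uj := \mxrow_i first_blocks U i in
  let Aj := pg_matrix A Uj Z in
  let Pi := pg_oblique Uj Z in
  let Gamma := submxblock H ord_max ord_max in
  let E1 := block_unit R[i] s (ord0 : 'I_j'.+1) in
  let Ej := block_unit R[i] s (ord_max : 'I_j'.+1) in
  let Fj := Uj *m matfun f Aj *m E1 *m RB in
  let G h := Ej^t* *m invmx (top_blocks K)
             *m (matfun f Aj - (f (lambda h))%:M)
             *m invmx (Aj - (lambda h)%:M) *m E1 *m RB in
  (1 < s)%N ->
  (forall a, Some a \in Sigma -> ~~ eigenvalue A a) ->
  block_rational_arnoldi A B Sigma U RB H K ->
  Z^t* *m Z = 1%:M ->
  Z^t* *m Uj \in unitmx ->
  (forall a, Some a \in Sigma -> ~~ eigenvalue Aj a) ->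
  analytic_near f [set a | eigenvalue A a \/ eigenvalue Aj a] ->
  (forall a, eigenvalue A a -> ~~ eigenvalue Aj a) ->
  X \in unitmx ->
  A = \sum_(h < n) lambda h *: (col h X *m row h (invmx X)) ->
  matfun f A *m B - Fj
    = \sum_(h < n) col h X *m row h (invmx X) *m Pi *m U ord_max *m Gamma *m G h
  /\
  frobenius_norm (matfun f A *m B - Fj)
    <= cond2 X * frobenius_norm (Pi *m U ord_max *m Gamma)
       * \big[Num.max/0]_(h < n) norm2 (G h).
Proof.
move=> Uj Aj Pi Gamma E1 Ej Fj G _ _ arn _ uZU _ _ disj uX EA.
have AU : A *m Uj
    = Uj *m Aj + Pi *m U ord_max *m Gamma *m (Ej^t* *m invmx (top_blocks K)).
  rewrite {1}(mulmx_pg_matrix A Uj Z) (arnoldi_residual arn) mulmxDr.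
  by rewrite [Pi *m (Uj *m _)]mulmxA (pg_oblique_basis uZU) mul0mx add0r !mulmxA.
have EB : B = Uj *m (E1 *m RB).
  rewrite mulmxA mulmx_block_unit (bra_start arn) /first_blocks.
  by congr (U _ *m _); apply: val_inj.
have error : matfun f A *m B - Fj
    = \sum_(h < n) col h X *m row h (invmx X) *m Pi *m U ord_max *m Gamma *m G h.
  rewrite /Fj {1}EB -[_ *m E1 *m RB]mulmxA.
  rewrite (matfun_compression_error f _ uX EA AU disj).
  by apply: eq_bigr => h _; rewrite /G !mulmxA.
split=> //; rewrite error.
move: G {error} => G.
have := frob_eigen_sum X (Pi *m U ord_max *m Gamma) G.
by under eq_bigr => h _ do rewrite !mulmxA.
Qed.
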